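(* Let $\alpha>1$ and $C>0$. There exists a constant $C_*>0$ depending only on $\alpha$ and $C$ such that the following holds. Suppose the kernel satisfies $\Lambda_{i,j}\geq C(i+j)\log^{\alpha}(e+i\wedge j)$ for all $i,j\geq1$. Then every solution to the discrete OHS coagulation equations with $M_1^{\mathrm{in}}\in(0,\infty)$ gels in finite time, with $$T_{\mathrm{gel}}<\infty\quad\text{and}\quad T_{\mathrm{gel}}\leq\frac{C_*}{M_1^{\mathrm{in}}}.$$
   Context: $\mathbb{N}=\{1,2,3,\dots\}$, $i\wedge j:=\min(i,j)$, and $\log^\alpha x:=(\log x)^\alpha$. Given a kernel $\Lambda_{i,j}=\Lambda_{j,i}\geq 0$ ($i,j\in\mathbb{N}$) and initial data $\omega_i^{\mathrm{in}}\geq 0$ ($i\in\mathbb{N}$), the discrete Oort--Hulst--Safronov (OHS) coagulation equations are $$\frac{d\omega_i}{dt}(t)=\omega_{i-1}(t)\sum_{j=1}^{i-1}j\Lambda_{i-1,j}\omega_j(t)-\omega_i(t)\sum_{j=1}^{i}j\Lambda_{i,j}\omega_j(t)-\sum_{j=i}^{\infty}\Lambda_{i,j}\omega_i(t)\omega_j(t),\quad i\in\mathbb{N},$$ with $\omega_i(0)=\omega_i^{\mathrm{in}}$ (the first term is absent, i.e. $0$, when $i=1$). A solution is a family $(\omega_i(t))_{i\in\mathbb{N},t\geq0}$ of nonnegative real numbers such that: for each $i$, $t\mapsto\omega_i(t)$ is locally absolutely continuous on $[0,\infty)$; for every $T>0$ and $i\in\mathbb{N}$, $\int_0^T\big[\omega_i(s)\sum_{j=1}^{i}j\Lambda_{i,j}\omega_j(s)+\omega_i(s)\sum_{j=i}^\infty\Lambda_{i,j}\omega_j(s)\big]ds<\infty$;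 the equation holds for Lebesgue-a.e. $t\geq0$ and every $i\in\mathbb{N}$; and $\omega_i(0)=\omega_i^{\mathrm{in}}$ for all $i\in\mathbb{N}$. $M_1(t):=\sum_{i=1}^\infty i\,\omega_i(t)$ is the total mass, $M_1^{\mathrm{in}}:=\sum_{i=1}^\infty i\,\omega_i^{\mathrm{in}}$, and the gelation time is $T_{\mathrm{gel}}:=\inf\{t\geq0: M_1(t)<M_1^{\mathrm{in}}\}$ (with $\inf\emptyset=+\infty$). *)

(* Defs.v *)
From HB Require Import structures.
From mathcomp Require Import all_boot all_order all_algebra.
From mathcomp Require Import all_classical all_reals all_analysis.

Set Implicit Arguments.
Unset Strict Implicit.
Unset Printing Implicit Defensive.

Import Order.TTheory GRing.Theory Num.Theory.
Import numFieldNormedType.Exports.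

Local Open Scope classical_set_scope.
Local Open Scope ring_scope.

(* Families indexed by the positive integers are functions on [nat] whose value
   at index 0 is irrelevant; functions of time t >= 0 are functions on [R] whose
   values at negative times are irrelevant. Series of nonnegative terms are
   taken in the extended reals, where 0 * +oo = 0. *)

Definition absolutely_continuous_on (R : realType) (a b : R) (f : R -> R) : Prop :=
  forall e : R, 0 < e -> exists2 d : R, 0 < d &
    forall (n : nat) (x y : 'I_n -> R),
      (forall k, a <= x k /\ x k <= y k /\ y k <= b) ->
      trivIset [set: 'I_n] (fun k => `]x k, y k[%classic) ->
      \sum_(k < n) (y k - x k) < d ->
      \sum_(k < n) `|f (y k) - f (x k)| < e.

Definition locally_absolutely_continuous (R : realType) (f : R -> R) : Prop :=
  forall T : R, 0 < T -> absolutely_continuous_on 0 T f.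

Definition coagulation_kernel (R : realType) (L : nat -> nat -> R) : Prop :=
  forall i j : nat, (0 < i)%N -> (0 < j)%N -> L i j = L j i /\ 0 <= L i j.

(* For i = 1 the sum is empty, so that w 0 plays no role. *)
Definition OHS_gain (R : realType) (L : nat -> nat -> R) (w : nat -> R)
    (i : nat) : R :=
  w i.-1 * \sum_(1 <= j < i) j%:R * L i.-1 j * w j.

Definition OHS_loss_small (R : realType) (L : nat -> nat -> R) (w : nat -> R)
    (i : nat) : R :=
  w i * \sum_(1 <= j < i.+1) j%:R * L i j * w j.

Definition OHS_loss_large (R : realType) (L : nat -> nat -> R) (w : nat -> R)
    (i : nat) : \bar R :=
  (\sum_(i <= j <oo) (L i j * w i * w j)%:E)%E.

(* The ODE is stated in the extended reals: as its left-hand side is finite, it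
   forces the series in [OHS_loss_large] to converge. *)
Record OHS_solution (R : realType) (L : nat -> nat -> R) (win : nat -> R)
    (w : nat -> R -> R) : Prop := {
  OHS_ge0 : forall (i : nat) (t : R), (0 < i)%N -> 0 <= t -> 0 <= w i t ;
  OHS_ac : forall i : nat, (0 < i)%N -> locally_absolutely_continuous (w i) ;
  OHS_integrable : forall (T : R) (i : nat), 0 < T -> (0 < i)%N ->
    (\int[lebesgue_measure]_(s in `[0%R, T])
       ((w i s * \sum_(1 <= j < i.+1) j%:R * L i j * w j s)%R%:E
        + (w i s)%:E * \sum_(i <= j <oo) (L i j * w j s)%:E) < +oo)%E ;
  OHS_ode : {ae lebesgue_measure, forall t : R, 0 <= t ->
    forall i : nat, (0 < i)%N ->
      derivable (w i) t 1 /\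
      ((derive1 (w i) t)%:E =
         (OHS_gain L (w ^~ t) i)%:E - (OHS_loss_small L (w ^~ t) i)%:E
         - OHS_loss_large L (w ^~ t) i)%E} ;
  OHS_init : forall i : nat, (0 < i)%N -> w i 0 = win i
}.

Definition mass (R : realType) (v : nat -> R) : \bar R :=
  (\sum_(1 <= i <oo) (i%:R * v i)%:E)%E.

Definition gelation_time (R : realType) (win : nat -> R) (w : nat -> R -> R) :
    \bar R :=
  ereal_inf [set t%:E | t in [set t : R | 0 <= t /\ (mass (w ^~ t) < mass win)%E]].

(* Main.v *)
Require Import Defs.
From HB Require Import structures.
From mathcomp Require Import all_boot all_order all_algebra.
From mathcomp Require Import all_classical all_reals all_analysis measurable_realfun.
From mathcomp Require Import ring lra.

Set Implicit Arguments.
Unset Strict Implicit.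
Unset Printing Implicit Defensive.

Import Order.TTheory GRing.Theory Num.Theory.
Import numFieldNormedType.Exports.

Local Open Scope classical_set_scope.
Local Open Scope ring_scope.

(** For a test sequence [phi], a solution formally satisfies
<<
  d/dt sum_i phi_i w_i
    = sum_(j <= i) L_ij w_i w_j (j (phi_(i+1) - phi_i) - phi_j).
>>
    With [phi_i = i] the bracket vanishes: mass is formally conserved. The idea
    is to take a slightly sublinear [phi] whose bracket is negative enough to
    compensate the logarithm in the kernel. Let [phi] have the slowly
    decreasing increments [d_k = ln (e + k) ^ (1 - alpha)]. Then [phi_j / j] is
    the mean of [d_0, ..., d_(j-1)], and by concavity it exceeds [d_j], hence
    every later increment [d_i], by at least a multiple of
    [ln (e + j) ^ (- alpha)] ([log_weight_concavity_gap]). Since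
    [L_ij >= C (i + j) ln (e + j) ^ alpha] for [j <= i], the logarithms cancel
    and
<<
  d/dt sum_i phi_i w_i <= - kappa (sum_i i w_i) ^ 2,
  kappa = C (alpha - 1) / (4 e).
>>
    As [phi_i <= i], the left-hand moment is initially at most [M = mass win] and stays
    nonnegative, so the mass cannot remain at least [M] up to a time of order
    [1 / (kappa M)].

    Everything is carried out on moments truncated at an index [n]. Truncation
    only drops nonpositive contributions, so the inequalities survive
    ([truncated_moment_rate]), and only finite sums are ever differentiated.
    Moreover the truncated mass is nonincreasing in time, so if
    [sum_(i <= n) i w_i] exceeds [M / 2] at time [T], it did so on all of
    [[0, T]]; the decay of the truncated moment by [kappa T (M / 2) ^ 2] then
    follows without integrating in time. For [T = 8 / (kappa M)] this decay is
    [2 M], more than the initial value allows.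

    The solution is only absolutely continuous and solves the equation almost
    everywhere, so these differential inequalities rest on
    [absolutely_continuous_derive1_le0]: an absolutely continuous function whose
    derivative is almost everywhere nonpositive does not increase. *)

(** * Absolutely continuous functions with nonpositive derivative *)

(** Cousin's covering argument. Additivity lets the intervals on which [P] holds
    be glued together; the supremum of the points reached from [a] must then be
    [b], for the local hypothesis at that supremum allows one further step. *)
Lemma interval_cover_induction (R : realType) (a b : R) (P : R -> R -> Prop) :
  a <= b ->
  (forall x y z, a <= x -> x <= y -> y <= z -> z <= b ->
     P x y -> P y z -> P x z) ->
  (forall x, a <= x -> x <= b -> exists2 d : R, 0 < d &
     forall y z, a <= y -> y <= x -> x <= z -> z <= b ->
       x - d < y -> z < x + d -> P y z) ->
  P a b.
Proof.
move=> ab Padd Ploc.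
pose S := [set x : R | [/\ a <= x, x <= b & P a x]].
have Sa : S a.
  have [d d0 Pd] := Ploc a (lexx a) ab.
  by split=> //; apply: Pd => //; lra.
have Sub : ubound S b by move=> x [].
have supS : has_sup S by split; [exists a|exists b].
have ac : a <= sup S by apply: ub_le_sup => //; exists b.
have cb : sup S <= b by apply: ge_sup => //; exists a.
have [d d0 Pd] := Ploc _ ac cb.
have [x [ax xb Pax] xc] := sup_adherent d0 supS.
have xS : x <= sup S by apply: ub_le_sup => //; exists b.
pose z := Num.min b (sup S + d / 2).
have cz : sup S <= z by rewrite /z le_min cb; lra.
have zb : z <= b by rewrite /z ge_min lexx.
have zd : z <= sup S + d / 2 by rewrite /z ge_min lexx orbT.
have Sz : S z.
  split=> //; first exact: le_trans ac cz.
  apply: (Padd a x z) => //; first exact: le_trans xS cz.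
  by apply: Pd => //; lra.
have zc : z <= sup S by apply: ub_le_sup => //; exists b.
have zE : z = b.
  by move: zc; rewrite /z; case: (leP b (sup S + d / 2)) => //; lra.
by case: Sz => _ _; rewrite zE.
Qed.

Definition total_length {R : realType} (s : seq (R * R)) : R :=
  \sum_(p <- s) (p.2 - p.1).

Definition total_variation_on {R : realType} (f : R -> R) (s : seq (R * R)) : R :=
  \sum_(p <- s) `|f p.2 - f p.1|.

(** Weak inequalities: intervals may degenerate to points and share endpoints,
    so that concatenating chains over adjacent intervals gives a chain. *)
Definition chain_of_intervals {R : realType} (s : seq (R * R)) : bool :=
  all (fun p => p.1 <= p.2) s && pairwise (fun p q => p.2 <= q.1) s.

Lemma chain_trivIset (R : realType) (s : seq (R * R)) :
  chain_of_intervals s ->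
  trivIset [set: 'I_(size s)]
    (fun k => `](nth (0, 0) s k).1, (nth (0, 0) s k).2[%classic).
Proof.
move=> /andP[_ /(pairwiseP (0, 0)) sP]; apply/trivIsetP => i j _ _ ij.
apply/seteqP; split=> x //= [].
rewrite !in_itv/= => /andP[xi1 xi2] /andP[xj1 xj2].
have : (i < j)%N || (j < i)%N by rewrite -neq_ltn.
case/orP => ltij.
- have := sP i j; rewrite !inE => /(_ (ltn_ord i) (ltn_ord j) ltij); lra.
- have := sP j i; rewrite !inE => /(_ (ltn_ord j) (ltn_ord i) ltij); lra.
Qed.

Lemma chain_length_le_measure (R : realType) (s : seq (R * R)) (U : set R) :
  open U -> chain_of_intervals s ->
  (forall p, p \in s -> `]p.1, p.2[ `<=` U) ->
  ((total_length s)%:E <= lebesgue_measure U)%E.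
Proof.
move=> oU cs sU.
pose F (k : 'I_(size s)) := `](nth (0, 0) s k).1, (nth (0, 0) s k).2[%classic.
have mF k : measurable (F k) by exact: measurable_itv.
have mbigF : measurable (\big[setU/set0]_(k < size s) F k).
  exact: bigsetU_measurable.
have -> : (total_length s)%:E
    = lebesgue_measure (\big[setU/set0]_(k < size s) F k).
  rewrite measure_semi_additive_ord//; last exact: chain_trivIset.
  rewrite /total_length (big_nth (0, 0)) big_mkord -sumEFin.
  apply: eq_bigr => k _;
  rewrite [RHS](lebesgue_measure_itv `](nth (0, 0) s k).1, (nth (0, 0) s k).2[)/=.
  rewrite lte_fin.
  have /andP[/allP /(_ _ (mem_nth (0, 0) (ltn_ord k))) ge12 _] := cs.
  by case: ltgtP ge12 => // <- _; rewrite subrr.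
apply: le_measure; rewrite ?inE//; first exact: open_measurable.
elim/big_rec: _ => [|k A _ AU]; first exact: sub0set.
by rewrite subUset; split => //; apply: sU; apply: mem_nth.
Qed.

(** Families indexed by ordinals are awkward to concatenate; this rephrases
    absolute continuity for lists of intervals. *)
Lemma absolutely_continuous_chain (R : realType) (a b e : R) (f : R -> R) :
  absolutely_continuous_on a b f -> 0 < e ->
  exists2 d : R, 0 < d & forall s : seq (R * R),
    chain_of_intervals s -> (forall p, p \in s -> a <= p.1 /\ p.2 <= b) ->
    total_length s < d -> total_variation_on f s < e.
Proof.
move=> acf e0; have [d d0 H] := acf e e0; exists d => // s cs sab sd.
rewrite /total_variation_on (big_nth (0, 0)) big_mkord.
apply: (H _ (fun k => (nth (0, 0) s k).1) (fun k => (nth (0, 0) s k).2)).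
- move=> k; have ks := mem_nth (0, 0) (ltn_ord k).
  have /andP[/allP /(_ _ ks) ge12 _] := cs.
  by have [? ?] := sab _ ks.
- exact: chain_trivIset.
- by move: sd; rewrite /total_length (big_nth (0, 0)) big_mkord.
Qed.

Lemma chain_cat (R : realType) (s1 s2 : seq (R * R)) (y : R) :
  chain_of_intervals s1 -> chain_of_intervals s2 ->
  (forall p, p \in s1 -> p.2 <= y) -> (forall p, p \in s2 -> y <= p.1) ->
  chain_of_intervals (s1 ++ s2).
Proof.
move=> /andP[a1 p1] /andP[a2 p2] s1y s2y.
rewrite /chain_of_intervals all_cat a1 a2/= pairwise_cat p1 p2 !andbT.
apply/allrelP => p q ps qs; exact: le_trans (s1y _ ps) (s2y _ qs).
Qed.

(** The straddle inequality: both endpoints may move, as long as [x] stays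
    between them. This is the form in which differentiability at a tag [x] enters
    a covering argument. *)
Lemma derive1_le0_slope (R : realType) (f : R -> R) (x e : R) :
  derivable f x 1 -> derive1 f x <= 0 -> 0 < e ->
  exists2 d : R, 0 < d & forall y z, y <= x -> x <= z -> x - d < y -> z < x + d ->
    f z - f y <= e * (z - y).
Proof.
move=> df f'0 e0.
have : (fun h => h^-1 *: (f (h + x) - f x)) @ 0^' --> derive1 f x.
  rewrite derive1E; move: df => /derivableP[/=]; rewrite /derivable.
  move=> + _; rewrite /derive/=; under eq_fun do rewrite -[_ *: 1]/(_ * 1) mulr1.
  by [].
move=> /cvgrPdist_lt /(_ e e0) [d /= d0 Hd].
exists d => // y z yx xz xy zx.
have right h : 0 <= h -> h < d -> f (h + x) - f x <= e * h.
  rewrite le_eqVlt => /predU1P[<-|h0] hd; first by rewrite add0r subrr mulr0.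
  have := Hd h; rewrite /= sub0r normrN gtr0_norm// => /(_ hd).
  move=> /(_ (lt0r_neq0 h0)); rewrite ltr_norml => /andP[+ _].
  set q := _ *: _ => qe.
  have -> : f (h + x) - f x = q * h.
    by rewrite /q -[_ *: _]/(_ * _) mulrAC mulVf ?mul1r// lt0r_neq0.
  by rewrite ler_pM2r//; lra.
have left h : h <= 0 -> - d < h -> f x - f (h + x) <= e * - h.
  rewrite le_eqVlt => /predU1P[->|h0] hd; first by rewrite add0r subrr oppr0 mulr0.
  have hd' : `|h| < d by rewrite ltr0_norm//; lra.
  have := Hd h; rewrite /= sub0r normrN => /(_ hd').
  move=> /(_ (ltr0_neq0 h0)); rewrite ltr_norml => /andP[+ _].
  set q := _ *: _ => qe.
  have -> : f x - f (h + x) = q * - h.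
    rewrite /q -[_ *: _]/(_ * _) mulrN mulrAC mulVf ?mul1r ?opprB//.
    by rewrite ltr0_neq0.
  by rewrite ler_pM2r ?oppr_gt0//; lra.
have := right (z - x); rewrite subrK => R1.
have := left (y - x); rewrite subrK => L1.
have {}R1 := R1 ltac:(lra) ltac:(lra).
have {}L1 := L1 ltac:(lra) ltac:(lra).
by lra.
Qed.

(** Enclose the exceptional null set in an open set [U] of small measure. A point
    outside [U] is good, and [f] increases by at most [e * (z - y)] on short
    intervals [[y, z]] around it; a short interval around a point of [U] lies in
    [U]. Covering [[a, b]] by such intervals, the first kind contributes at most
    [e * (b - a)] and the second at most [e], by absolute continuity, because
    their total length is at most the measure of [U]. *)
Lemma absolutely_continuous_derive1_le0 (R : realType) (a b : R) (f : R -> R) :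
  a <= b -> absolutely_continuous_on a b f ->
  {ae lebesgue_measure, forall t : R, a <= t -> t <= b ->
     derivable f t 1 /\ derive1 f t <= 0} ->
  f b <= f a.
Proof.
move=> ab acf [D [mD D0 DP]].
suff main e : 0 < e -> f b - f a <= e * (b - a) + e.
  apply/ler_addgt0Pr => e e0.
  have ba0 : 0 < b - a + 1 by lra.
  have := main _ (divr_gt0 e0 ba0).
  rewrite -[X in _ <= _ + X]mulr1 -mulrDr mulfVK ?lt0r_neq0//.
  by rewrite lerBlDl.
move=> e0; have [d d0 acd] := absolutely_continuous_chain acf e0.
have [|U [oU DU UD]] := lebesgue_regularity_outer mD _ d0.
  by rewrite [X in (X < _)%E]D0.
have mU : measurable U by exact: open_measurable.
have Ud : (lebesgue_measure U < d%:E)%E.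
  have := measureDI lebesgue_measure mU mD.
  rewrite (@subset_measure0 _ _ _ lebesgue_measure (U `&` D) D) ?adde0//.
  - by move=> ->.
  - exact: measurableI.
(* [s] lists the intervals of the second kind used to go from [y] to [z]. *)
pose P y z := exists s : seq (R * R), [/\ chain_of_intervals s,
  forall p, p \in s -> y <= p.1 /\ p.2 <= z,
  forall p, p \in s -> `]p.1, p.2[ `<=` U &
  f z - f y <= e * (z - y) + total_variation_on f s].
suff [s [cs sab sU fs]] : P a b.
  have := acd s cs sab; have := chain_length_le_measure oU cs sU.
  move=> /le_lt_trans /(_ Ud); rewrite lte_fin => sd /(_ sd).
  by lra.
apply: interval_cover_induction => //.
- move=> x y z ax xy yz zb [s1 [c1 b1 U1 v1]] [s2 [c2 b2 U2 v2]].
  exists (s1 ++ s2); split.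
  + apply: (@chain_cat _ _ _ y) => // p; first by move=> /b1[].
    by move=> /b2[].
  + move=> p; rewrite mem_cat => /orP[/b1|/b2] [? ?]; split => //; lra.
  + by move=> p; rewrite mem_cat => /orP[/U1|/U2].
  + rewrite /total_variation_on big_cat/=.
    rewrite /total_variation_on in v1 v2; lra.
- move=> x ax xb.
  have [xU|xU] := pselect (U x).
    have /nbhs_ballP[r /= r0 rU] : nbhs x U by exact: open_nbhs_nbhs.
    exists r => // y z ay yx xz zb ry zr.
    exists [:: (y, z)]; split.
    + by rewrite /chain_of_intervals/= !andbT; lra.
    + by move=> p; rewrite inE => /eqP ->.
    + move=> p; rewrite inE => /eqP -> u /=; rewrite in_itv/= => /andP[yu uz].
      by apply: rU; rewrite /ball/= ltr_norml; lra.
    + rewrite /total_variation_on big_seq1/=.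
      have := ler_norm (f z - f y).
      suff : 0 <= e * (z - y) by lra.
      by rewrite mulr_ge0//; lra.
  have [df f'] : derivable f x 1 /\ derive1 f x <= 0.
    apply: contrapT => H; apply/xU/DU/DP => /= /(_ ax xb); exact: H.
  have [r r0 Hr] := derive1_le0_slope df f' e0.
  exists r => // y z ay yx xz zb ry zr.
  exists [::]; split => //; rewrite /total_variation_on big_nil addr0.
  exact: Hr.
Qed.

(** * Differential inequalities for finite weighted sums *)

Lemma absolutely_continuous_onD (R : realType) (a b : R) (f g : R -> R) :
  absolutely_continuous_on a b f -> absolutely_continuous_on a b g ->
  absolutely_continuous_on a b (fun t => f t + g t).
Proof.
move=> acf acg e e0; have e20 : 0 < e / 2 by lra.
have [d1 d10 H1] := acf _ e20; have [d2 d20 H2] := acg _ e20.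
exists (Num.min d1 d2); first by rewrite lt_min d10.
move=> n x y xy tI; rewrite lt_min => /andP[xd1 xd2].
have := H1 n x y xy tI xd1; have := H2 n x y xy tI xd2.
suff : \sum_(k < n) `|f (y k) + g (y k) - (f (x k) + g (x k))| <=
    \sum_(k < n) `|f (y k) - f (x k)| + \sum_(k < n) `|g (y k) - g (x k)| by lra.
rewrite -big_split/=; apply: ler_sum => k _.
by rewrite opprD addrACA; exact: ler_normD.
Qed.

Lemma absolutely_continuous_onZ (R : realType) (a b c : R) (f : R -> R) :
  absolutely_continuous_on a b f ->
  absolutely_continuous_on a b (fun t => c * f t).
Proof.
move=> acf e e0; have c0 : 0 < `|c| + 1 by rewrite ltr_wpDl.
have [d d0 H] := acf _ (divr_gt0 e0 c0); exists d => // n x y xy tI xd.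
have := H n x y xy tI xd; rewrite ltr_pdivlMr//; apply: le_lt_trans.
rewrite mulrC mulr_sumr; apply: ler_sum => k _.
by rewrite -mulrBr normrM ler_wpM2r// lerDl.
Qed.

Lemma absolutely_continuous_on_id (R : realType) (a b : R) :
  absolutely_continuous_on a b id.
Proof.
move=> e e0; exists e => // n x y xy tI; apply: le_lt_trans.
apply: ler_sum => k _; have [_ [? _]] := xy k.
by rewrite ger0_norm// subr_ge0.
Qed.

Lemma absolutely_continuous_onS (R : realType) (a b a' b' : R) (f : R -> R) :
  a <= a' -> b' <= b ->
  absolutely_continuous_on a b f -> absolutely_continuous_on a' b' f.
Proof.
move=> aa bb acf e e0; have [d d0 H] := acf _ e0; exists d => // n x y xy.
apply: H => k; have [? [? ?]] := xy k.
by split; [exact: le_trans aa _|split => //; exact: le_trans bb].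
Qed.

Lemma absolutely_continuous_on_sum (R : realType) (a b : R) (c : nat -> R)
    (w : nat -> R -> R) (n : nat) :
  (forall i, (0 < i)%N -> absolutely_continuous_on a b (w i)) ->
  absolutely_continuous_on a b (fun t => \sum_(1 <= i < n.+1) c i * w i t).
Proof.
move=> acw; elim: n => [|n IH].
  under eq_fun do rewrite big_geq//.
  move=> e e0; exists 1 => // n x y _ _ _.
  by under eq_bigr do rewrite subrr normr0; rewrite big1.
under eq_fun do rewrite big_nat_recr//=.
exact: (absolutely_continuous_onD IH (absolutely_continuous_onZ _ (acw _ _))).
Qed.

Lemma is_derive_weighted_sum (R : realType) (c : nat -> R) (w : nat -> R -> R)
    (n : nat) (t : R) :
  (forall i, (0 < i)%N -> derivable (w i) t 1) ->
  is_derive t 1 (fun s => \sum_(1 <= i < n.+1) c i * w i s)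
    (\sum_(1 <= i < n.+1) c i * derive1 (w i) t).
Proof.
move=> dw; elim: n => [|n IH].
  under eq_fun do rewrite big_geq//.
  by rewrite big_geq//; exact: (is_derive_cst (0 : R) t 1).
under eq_fun do rewrite big_nat_recr//=.
rewrite big_nat_recr//= derive1E.
apply: is_deriveD; apply: is_deriveZ.
exact/derivableP/dw.
Qed.

Lemma weighted_sum_decay (R : realType) (c : nat -> R) (w : nat -> R -> R)
    (n : nat) (k a b : R) : 0 <= a -> a <= b ->
  (forall i, (0 < i)%N -> locally_absolutely_continuous (w i)) ->
  {ae lebesgue_measure, forall t : R, a <= t -> t <= b ->
    (forall i, (0 < i)%N -> derivable (w i) t 1) /\
    \sum_(1 <= i < n.+1) c i * derive1 (w i) t <= - k} ->
  \sum_(1 <= i < n.+1) c i * w i b + k * (b - a)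
    <= \sum_(1 <= i < n.+1) c i * w i a.
Proof.
move=> a0 ab acw Hae.
pose f t := \sum_(1 <= i < n.+1) c i * w i t + k * t.
suff : f b <= f a by rewrite /f; lra.
apply: absolutely_continuous_derive1_le0 => //.
  refine (absolutely_continuous_onD (absolutely_continuous_on_sum _ _ _)
    (absolutely_continuous_onZ _ (absolutely_continuous_on_id _ _))) => i i0.
  apply: (@absolutely_continuous_onS _ 0 (b + 1)) => //; first by lra.
  by apply: acw => //; lra.
apply: negligibleS Hae; apply: subsetC => t /= Ht ta tb; have [dw le] := Ht ta tb.
have df : is_derive t 1 f (\sum_(1 <= i < n.+1) c i * derive1 (w i) t + k * 1).
  by apply: is_deriveD; exact: is_derive_weighted_sum.
split; first by case: df.
rewrite derive1E derive_val; lra.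
Qed.

(** * Moments of the truncated coagulation operator *)

Lemma triangular_exchange (R : realType) (F : nat -> nat -> R) (n : nat) :
  \sum_(1 <= i < n.+1) \sum_(i <= j < n.+1) F i j =
  \sum_(1 <= i < n.+1) \sum_(1 <= j < i.+1) F j i.
Proof.
elim: n => [|n IH]; first by rewrite !big_geq.
rewrite [RHS]big_nat_recr//= -IH [LHS]big_nat_recr//= big_nat1.
rewrite [\sum_(1 <= j < n.+2) F j n.+1]big_nat_recr//= addrA; congr (_ + _).
rewrite -big_split/=; apply: eq_big_nat => i /andP[_ ni].
by rewrite big_nat_recr//= ltnW.
Qed.

(** The triangle [j <= i] carries at least half of the symmetric double sum. *)
Lemma square_le_triangular (R : realType) (u : nat -> R) (n : nat) :
  (forall i, (0 < i)%N -> 0 <= u i) ->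
  (\sum_(1 <= i < n.+1) u i) ^+ 2 / 2 <=
  \sum_(1 <= i < n.+1) \sum_(1 <= j < i.+1) u i * u j.
Proof.
move=> u0; elim: n => [|n IH]; first by rewrite !big_geq// expr2 mul0r mul0r.
rewrite ![\sum_(1 <= i < n.+2) _]big_nat_recr//= -mulr_sumr.
have := u0 n.+1 isT; nra.
Qed.

(** Shifting the index in the gain term and exchanging the sums in the last loss
    term collects everything over pairs [j <= i], with the factor
    [j (phi_(i+1) - phi_i) - phi_j]. Cutting the sums at [n] amounts to setting
    [phi_(n+1)] to [0], which, as [phi >= 0], only lowers the factors of the pairs
    with [i = n]. *)
Lemma truncated_moment_rate (R : realType) (L : nat -> nat -> R) (v phi b : nat -> R)
    (n : nat) :
  coagulation_kernel L ->
  (forall i, (0 < i)%N -> 0 <= v i) -> (forall i, (0 < i)%N -> 0 <= phi i) ->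
  (forall i j, (0 < j)%N -> (j <= i)%N ->
     j%:R * (phi i.+1 - phi i) - phi j <= - (j%:R * b j)) ->
  \sum_(1 <= i < n.+1) phi i * (OHS_gain L v i - OHS_loss_small L v i
      - \sum_(i <= j < n.+1) L i j * v i * v j) <=
  - \sum_(1 <= i < n.+1) \sum_(1 <= j < i.+1) j%:R * b j * (L i j * v i * v j).
Proof.
move=> kL v0 phi0 H.
(* The gain of cluster [i + 1] is the first loss of cluster [i]; on the right,
   the spurious gain of cluster [n + 1] is added. *)
have gain_le : \sum_(1 <= i < n.+1) phi i * OHS_gain L v i <=
    \sum_(1 <= i < n.+1) phi i.+1 * OHS_loss_small L v i.
  apply: (@le_trans _ _ (\sum_(1 <= i < n.+2) phi i * OHS_gain L v i)).
    rewrite [leRHS]big_nat_recr//= lerDl mulr_ge0 ?phi0//.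
    rewrite /OHS_gain/=; case: n => [|n]; first by rewrite big_geq// mulr0.
    rewrite mulr_ge0 ?v0// big_nat_cond sumr_ge0// => j /andP[/andP[j0 _] _].
    by rewrite !mulr_ge0 ?v0//; case: (kL n.+1 j isT j0).
  rewrite big_nat_recl//= {1}/OHS_gain [X in _ * (_ * X)]big_geq// !mulr0 add0r.
  exact: lexx.
have large : \sum_(1 <= i < n.+1) phi i * \sum_(i <= j < n.+1) L i j * v i * v j =
    \sum_(1 <= i < n.+1) \sum_(1 <= j < i.+1) phi j * (L i j * v i * v j).
  under eq_bigr do rewrite mulr_sumr.
  rewrite triangular_exchange; apply: eq_big_nat => i /andP[i0 _].
  apply: eq_big_nat => j /andP[j0 _]; have [-> _] := kL j i j0 i0.
  by rewrite -!mulrA [v j * _]mulrC.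
under eq_bigr do rewrite !mulrBr.
rewrite !sumrB large.
apply: (@le_trans _ _ (\sum_(1 <= i < n.+1) ((phi i.+1 - phi i) * OHS_loss_small L v i
   - \sum_(1 <= j < i.+1) phi j * (L i j * v i * v j)))).
  rewrite sumrB; under [X in _ <= X - _]eq_bigr do rewrite mulrBl.
  by rewrite sumrB; lra.
rewrite -[leRHS]sumrN; apply: ler_sum_nat => i /andP[i0 _].
rewrite /OHS_loss_small mulr_sumr mulr_sumr -sumrB -[leRHS]sumrN.
apply: ler_sum_nat => j /andP[j0 ji].
have [_ L0] := kL i j i0 j0.
have a0 : 0 <= L i j * v i * v j by rewrite !mulr_ge0 ?v0.
have := ler_wpM2r a0 (H i j j0 ji); lra.
Qed.

(** * The sublinear weight *)

(** The tangent-line bound for the convex function [x ^ (1 - alpha)] at [q]. *)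
Lemma powR_slope (R : realType) (alpha p q : R) : 1 < alpha -> 0 < p -> 0 < q ->
  (alpha - 1) * (q `^ alpha)^-1 * (q - p) <= p `^ (1 - alpha) - q `^ (1 - alpha).
Proof.
move=> alpha1 p0 q0; have a0 : 0 <= alpha - 1 by lra.
have pq0 : 0 < p / q by exact: divr_gt0.
have -> : p `^ (1 - alpha) = q `^ (1 - alpha) * (p / q) `^ (1 - alpha).
  by rewrite -powRM ?ltW// [q * _]mulrC mulfVK ?lt0r_neq0.
have -> : (q `^ alpha)^-1 = q `^ (1 - alpha) / q.
  rewrite powRB; last by rewrite (lt0r_neq0 q0) implybT.
  by rewrite powRr1 ?ltW// mulrAC mulfV ?mul1r// lt0r_neq0.
rewrite -[X in _ <= _ - X]mulr1 -mulrBr.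
have -> : (alpha - 1) * (q `^ (1 - alpha) / q) * (q - p) =
    q `^ (1 - alpha) * ((alpha - 1) * (1 - p / q)) by field; exact: lt0r_neq0.
apply: ler_wpM2l; first exact: powR_ge0.
rewrite /powR gt_eqF//.
have := expR_ge1Dx ((1 - alpha) * ln (p / q)).
have := le_ln1Dx (x := p / q - 1); rewrite addrCA subrr addr0.
move=> /(_ ltac:(lra)) /(ler_wpM2l a0).
set r := p / q; lra.
Qed.

Definition log_at (R : realType) (k : nat) : R := ln (expR 1 + k%:R).

Definition log_increment {R : realType} (alpha : R) (k : nat) : R :=
  log_at R k `^ (1 - alpha).

Definition log_weight {R : realType} (alpha : R) (i : nat) : R :=
  \sum_(k < i) log_increment alpha k.

Lemma log_at_ge1 (R : realType) k : 1 <= log_at R k.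
Proof.
by rewrite /log_at -[leLHS]expRK ler_ln ?posrE ?expR_gt0 ?lerDl ?ltr_wpDr ?expR_gt0.
Qed.

Lemma log_increment_le1 (R : realType) (alpha : R) k :
  1 < alpha -> log_increment alpha k <= 1.
Proof.
move=> alpha1.
rewrite /log_increment -[leRHS](powRr0 (log_at R k)).
by apply: ler_powR; [exact: log_at_ge1|lra].
Qed.

Lemma log_weight_ge0 (R : realType) (alpha : R) i : 0 <= log_weight alpha i.
Proof. by apply: sumr_ge0 => k _; exact: powR_ge0. Qed.

Lemma log_weight_le (R : realType) (alpha : R) i : 1 < alpha -> log_weight alpha i <= i%:R.
Proof.
move=> alpha1.
apply: (@le_trans _ _ (\sum_(k < i) 1)); last by rewrite sumr_const card_ord.
by apply: ler_sum => k _; exact: log_increment_le1.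
Qed.

(** Two tangent-line bounds composed, for the power and for the logarithm. *)
Lemma log_increment_slope (R : realType) (alpha : R) (k j : nat) :
  1 < alpha -> (k <= j)%N ->
  (alpha - 1) * (log_at R j `^ alpha)^-1 * ((j%:R - k%:R) / (expR 1 + j%:R))
    <= log_increment alpha k - log_increment alpha j.
Proof.
move=> alpha1 kj; have e0 : 0 < expR 1 :> R by exact: expR_gt0.
have k0 : 0 < expR 1 + k%:R :> R by rewrite ltr_wpDr.
have j0 : 0 < expR 1 + j%:R :> R by rewrite ltr_wpDr.
have lk := log_at_ge1 R k; have lj := log_at_ge1 R j.
apply: le_trans (powR_slope alpha1 _ _); [|lra|lra].
apply: ler_wpM2l; first by rewrite mulr_ge0 ?invr_ge0 ?powR_ge0//; lra.
have := @le_ln1Dx R ((expR 1 + k%:R) / (expR 1 + j%:R) - 1).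
rewrite addrCA subrr addr0 ln_div ?posrE// => H.
have kj0 := divr_gt0 k0 j0; have {}H := H ltac:(lra).
have -> : (j%:R - k%:R) / (expR 1 + j%:R)
    = 1 - (expR 1 + k%:R) / (expR 1 + j%:R) :> R by field; exact: lt0r_neq0.
by rewrite /log_at; lra.
Qed.

Lemma sum_distance_to (R : realType) (j m : nat) :
  \sum_(k < m) (j%:R - k%:R : R) = m%:R * j%:R - m%:R * (m%:R - 1) / 2.
Proof.
elim: m => [|m IH]; first by rewrite big_ord0; lra.
by rewrite big_ord_recr/= IH -natr1; field.
Qed.

(** The difference [log_weight j - j * log_increment j] is the sum over [k < j] of
    [log_increment k - log_increment j]. By [log_increment_slope] each term is at least
    [j - k] times a constant, and these distances sum to [j (j + 1) / 2];
    [(j + 1) / (e + j) >= 1 / e] gives the stated constant. Passing from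
    [log_increment j] to [log_increment i] is the monotonicity of increments. *)
Lemma log_weight_concavity_gap (R : realType) (alpha : R) (i j : nat) :
  1 < alpha -> (0 < j)%N -> (j <= i)%N ->
  j%:R * (log_weight alpha i.+1 - log_weight alpha i) - log_weight alpha j <=
  - (j%:R * ((alpha - 1) / (2 * expR 1) / log_at R j `^ alpha)).
Proof.
move=> alpha1 j0 ji.
have -> : log_weight alpha i.+1 - log_weight alpha i = log_increment alpha i.
  by rewrite /log_weight big_ord_recr/=; lra.
have e1 : 1 <= expR 1 :> R by have := expR_ge1Dx (1 : R); lra.
have A0 : 0 <= (alpha - 1) * (log_at R j `^ alpha)^-1.
  by rewrite mulr_ge0 ?invr_ge0 ?powR_ge0//; lra.
have j1 : 1 <= j%:R :> R by rewrite ler1n.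
have inc : log_increment alpha i <= log_increment alpha j.
  rewrite -subr_ge0; apply: le_trans (log_increment_slope alpha1 ji).
  rewrite mulr_ge0 ?divr_ge0 ?subr_ge0 ?ler_nat ?addr_ge0 ?expR_ge0 ?powR_ge0//.
  exact: ltW.
have : \sum_(k < j) ((alpha - 1) * (log_at R j `^ alpha)^-1 *
     ((j%:R - k%:R) / (expR 1 + j%:R))) <=
   \sum_(k < j) (log_increment alpha k - log_increment alpha j).
  by apply: ler_sum => k _; apply: log_increment_slope => //; exact: ltnW.
rewrite sumrB sumr_const card_ord -[log_increment alpha j *+ j]mulr_natl.
rewrite -/(log_weight alpha j) -mulr_sumr -mulr_suml.
rewrite sum_distance_to.
set A := _ * _^-1 in A0 *.
have -> : (alpha - 1) / (2 * expR 1) / log_at R j `^ alpha = A / (2 * expR 1).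
  by rewrite /A mulrAC.
have : j%:R / (2 * expR 1) <= (j%:R * j%:R - j%:R * (j%:R - 1) / 2) / (expR 1 + j%:R) :> R.
  have -> : j%:R * j%:R - j%:R * (j%:R - 1) / 2 = j%:R * (j%:R + 1) / 2 :> R by field.
  rewrite ler_pdivlMr; last by lra.
  rewrite [leLHS]mulrAC ler_pdivrMr; last by lra.
  nra.
move=> /(ler_wpM2l A0).
have : j%:R * log_increment alpha i <= j%:R * log_increment alpha j by apply: ler_wpM2l.
lra.
Qed.

(** * Decay of truncated moments along solutions *)

Lemma OHS_derive1_le (R : realType) (L : nat -> nat -> R) (v : nat -> R)
    (i n : nat) (x : R) :
  coagulation_kernel L -> (forall j, (0 < j)%N -> 0 <= v j) -> (0 < i)%N ->
  (x%:E = (OHS_gain L v i)%:E - (OHS_loss_small L v i)%:E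
          - OHS_loss_large L v i)%E ->
  x <= OHS_gain L v i - OHS_loss_small L v i
       - \sum_(i <= j < n.+1) L i j * v i * v j.
Proof.
move=> kL v0 i0 xE; rewrite -lee_fin xE !EFinB.
apply: leeB => //; rewrite -sumEFin /OHS_loss_large.
apply: nneseries_lim_ge => j ij _.
have j0 : (0 < j)%N by exact: leq_trans ij.
by rewrite lee_fin !mulr_ge0 ?v0//; case: (kL i j i0 j0).
Qed.

(** Integrated form of [truncated_moment_rate]; [k] is any lower bound for the
    dissipation on [[s, t]]. *)
Lemma OHS_moment_decay (R : realType) (L : nat -> nat -> R) (win : nat -> R)
    (w : nat -> R -> R) (phi b : nat -> R) (n : nat) (k s t : R) :
  coagulation_kernel L -> OHS_solution L win w ->
  (forall i, (0 < i)%N -> 0 <= phi i) ->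
  (forall i j, (0 < j)%N -> (j <= i)%N ->
     j%:R * (phi i.+1 - phi i) - phi j <= - (j%:R * b j)) ->
  0 <= s -> s <= t ->
  (forall r, s <= r -> r <= t -> k <= \sum_(1 <= i < n.+1) \sum_(1 <= j < i.+1)
     j%:R * b j * (L i j * w i r * w j r)) ->
  \sum_(1 <= i < n.+1) phi i * w i t + k * (t - s) <=
  \sum_(1 <= i < n.+1) phi i * w i s.
Proof.
move=> kL sol phi0 gap s0 st kle.
apply: weighted_sum_decay => //; first exact: OHS_ac sol.
apply: negligibleS (OHS_ode sol); apply: subsetC => r /= ode sr rt.
have r0 : 0 <= r by exact: le_trans sr.
split=> [i i0|]; first by case: (ode r0 i i0).
have w0 i : (0 < i)%N -> 0 <= w i r by move=> i0; exact: OHS_ge0 sol _ _ i0 r0.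
have := truncated_moment_rate n kL w0 phi0 gap; have := kle r sr rt.
suff : \sum_(1 <= i < n.+1) phi i * derive1 (w i) r <=
  \sum_(1 <= i < n.+1) phi i * (OHS_gain L (w ^~ r) i - OHS_loss_small L (w ^~ r) i
      - \sum_(i <= j < n.+1) L i j * w i r * w j r) by lra.
apply: ler_sum_nat => i /andP[i0 _]; apply: ler_wpM2l; first exact: phi0.
by apply: OHS_derive1_le => //; case: (ode r0 i i0).
Qed.

(** Mass crosses the truncation index upwards only. *)
Lemma truncated_mass_nonincreasing (R : realType) (L : nat -> nat -> R)
    (win : nat -> R) (w : nat -> R -> R) (n : nat) (s t : R) :
  coagulation_kernel L -> OHS_solution L win w -> 0 <= s -> s <= t ->
  \sum_(1 <= i < n.+1) i%:R * w i t <= \sum_(1 <= i < n.+1) i%:R * w i s.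
Proof.
move=> kL sol s0 st.
have := @OHS_moment_decay R L win w (fun i => i%:R) (fun=> 0) n 0 s t kL sol.
rewrite mul0r addr0; apply=> // [i j _ _|r _ _].
  by rewrite -natr1; lra.
by rewrite big1// => i _; rewrite big1// => j _; rewrite mulr0 mul0r.
Qed.

(** For [j <= i] the smaller index is [j], so the factor
    [ln (e + j) ^ alpha] of the kernel cancels the one in the gap of the weight,
    and [j * (i + j) >= i * j] leaves a square. *)
Lemma dissipation_ge_square (R : realType) (alpha C : R) (L : nat -> nat -> R)
    (v : nat -> R) (n : nat) :
  1 < alpha -> 0 < C ->
  (forall i j : nat, (0 < i)%N -> (0 < j)%N ->
     C * (i + j)%:R * ln (expR 1 + (minn i j)%:R) `^ alpha <= L i j) ->
  (forall i, (0 < i)%N -> 0 <= v i) ->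
  C * (alpha - 1) / (4 * expR 1) * (\sum_(1 <= i < n.+1) i%:R * v i) ^+ 2 <=
  \sum_(1 <= i < n.+1) \sum_(1 <= j < i.+1)
    j%:R * ((alpha - 1) / (2 * expR 1) / log_at R j `^ alpha)
      * (L i j * v i * v j).
Proof.
move=> alpha1 C0 CL v0.
have e0 : 0 < expR 1 :> R by exact: expR_gt0.
have D0 : 0 <= (alpha - 1) / (2 * expR 1) by rewrite divr_ge0//; lra.
have u0 i : (0 < i)%N -> 0 <= i%:R * v i by move=> i0; rewrite mulr_ge0 ?v0.
have CD0 : 0 <= C * ((alpha - 1) / (2 * expR 1)) by rewrite mulr_ge0// ltW.
have := ler_wpM2l CD0 (square_le_triangular n u0).
set S := \sum_(1 <= i < n.+1) i%:R * v i.
have -> : C * ((alpha - 1) / (2 * expR 1)) * (S ^+ 2 / 2) =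
    C * (alpha - 1) / (4 * expR 1) * S ^+ 2 by field; exact: lt0r_neq0.
move=> /le_trans; apply; rewrite mulr_sumr; apply: ler_sum_nat => i /andP[i0 _].
rewrite mulr_sumr; apply: ler_sum_nat => j /andP[j0]; rewrite ltnS => ji.
have := CL i j i0 j0; rewrite (minn_idPr ji) -/(log_at R j) => CLij.
have l0 : 0 < log_at R j `^ alpha.
  by apply: powR_gt0; apply: lt_le_trans (log_at_ge1 R j).
have iL : C * i%:R <= L i j / log_at R j `^ alpha.
  rewrite ler_pdivlMr//; apply: le_trans CLij.
  by rewrite ler_wpM2r ?(ltW l0)// ler_wpM2l ?(ltW C0)// ler_nat leq_addr.
have K0 : 0 <= (alpha - 1) / (2 * expR 1) * (j%:R * v j) * v i.
  by rewrite mulr_ge0 ?v0// mulr_ge0 ?u0.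
have := ler_wpM2l K0 iL.
set D := (alpha - 1) / _; set l := log_at R j `^ alpha.
by congr (is_true (_ <= _)); rewrite /= ; field => //; exact: lt0r_neq0.
Qed.

Lemma mass_partial_sum_gt (R : realType) (v : nat -> R) (c : R) :
  (forall i, (0 < i)%N -> 0 <= v i) -> (c%:E < mass v)%E ->
  exists n, c < \sum_(1 <= i < n.+1) i%:R * v i.
Proof.
move=> v0 cv; apply: contrapT => /forallNP H.
move: cv; rewrite ltNge => /negP; apply.
apply: lime_le.
  by apply: is_cvg_nneseries => i i0 _; rewrite lee_fin mulr_ge0// v0.
exists 1%N => // -[//|m] _ /=; rewrite sumEFin lee_fin leNgt.
exact/negP/H.
Qed.

Theorem proposition4p1 (R : realType) (alpha C : R) (halpha : 1 < alpha) (hC : 0 < C) :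
  exists2 Cstar : R, 0 < Cstar &
    forall (L : nat -> nat -> R) (win : nat -> R) (w : nat -> R -> R),
      coagulation_kernel L ->
      (forall i j : nat, (0 < i)%N -> (0 < j)%N ->
         C * (i + j)%:R * ln (expR 1 + (minn i j)%:R) `^ alpha <= L i j) ->
      (forall i : nat, (0 < i)%N -> 0 <= win i) ->
      OHS_solution L win w ->
      (0 < mass win < +oo)%E ->
      (gelation_time win w < +oo)%E /\
      (gelation_time win w <= (Cstar / fine (mass win))%:E)%E.
Proof.
set kappa := C * (alpha - 1) / (4 * expR 1).
have kappa0 : 0 < kappa.
  by rewrite divr_gt0 ?mulr_gt0 ?expR_gt0//; lra.
exists (8 / kappa); first exact: divr_gt0.
move=> L win w kL CL win0 sol /andP[mass0 massoo].
set m := fine (mass win).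
have mE : mass win = m%:E by rewrite fineK// gt0_fin_numE.
have m0 : 0 < m by rewrite -lte_fin -mE.
set T := 8 / kappa / m.
have T0 : 0 < T by rewrite divr_gt0// divr_gt0.
suff gel : (gelation_time win w <= T%:E)%E.
  by split=> //; apply: le_lt_trans gel _; exact: ltry.
apply: ereal_inf_lbound; exists T => //=; split; first exact: ltW.
rewrite ltNge; apply/negP => massT.
have wT0 i : (0 < i)%N -> 0 <= w i T by move=> i0; apply: (OHS_ge0 sol) => //; exact: ltW.
have [|n] := @mass_partial_sum_gt R (w ^~ T) (m / 2) wT0.
  by apply: lt_le_trans massT; rewrite mE lte_fin; lra.
set M := \sum_(1 <= i < n.+1) i%:R * w i T => Mm.
(* Dissipation at any earlier time is bounded below through the truncated mass
   at time [T]. *)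
have := @OHS_moment_decay R L win w (log_weight alpha)
  (fun j => (alpha - 1) / (2 * expR 1) / log_at R j `^ alpha) n
  (kappa * M ^+ 2) 0 T kL sol.
move=> /(_ (fun i _ => log_weight_ge0 alpha i)).
move=> /(_ (fun i j => log_weight_concavity_gap halpha)) /(_ (lexx 0) (ltW T0)).
rewrite subr0.
have /[swap]/[apply] : forall r, 0 <= r -> r <= T -> kappa * M ^+ 2 <=
  \sum_(1 <= i < n.+1) \sum_(1 <= j < i.+1)
    j%:R * ((alpha - 1) / (2 * expR 1) / log_at R j `^ alpha)
      * (L i j * w i r * w j r).
  move=> r r0 rT.
  have w0 i : (0 < i)%N -> 0 <= w i r by move=> i0; exact: (OHS_ge0 sol).
  apply: le_trans (dissipation_ge_square n halpha hC CL w0).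
  apply: ler_wpM2l; first exact: ltW.
  rewrite ler_sqr ?nnegrE; first exact: (truncated_mass_nonincreasing n kL sol).
  - by rewrite ltW//; lra.
  - by rewrite big_nat sumr_ge0// => i /andP[i0 _]; rewrite mulr_ge0 ?w0.
move=> decay.
have start : \sum_(1 <= i < n.+1) log_weight alpha i * w i 0 <= m.
  apply: (@le_trans _ _ (\sum_(1 <= i < n.+1) i%:R * win i)).
    apply: ler_sum_nat => i /andP[i0 _]; rewrite (OHS_init sol)//.
    by apply: ler_wpM2r; [exact: win0|exact: log_weight_le].
  rewrite -lee_fin -mE -sumEFin; apply: nneseries_lim_ge => i i0 _.
  by rewrite lee_fin mulr_ge0// win0.
have final : 0 <= \sum_(1 <= i < n.+1) log_weight alpha i * w i T.
  rewrite big_nat sumr_ge0// => i /andP[i0 _].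
  by rewrite mulr_ge0 ?log_weight_ge0 ?wT0.
(* [kappa * T = 8 / m] and [M > m / 2], so the moment would lose more than
   [2 * m], although it starts at most at [m]. *)
have M2 : m ^+ 2 / 4 < M ^+ 2 by nra.
have := ltr_pM2l (mulr_gt0 kappa0 T0) (m ^+ 2 / 4) (M ^+ 2).
rewrite M2; have -> : kappa * T * (m ^+ 2 / 4) = 2 * m.
  by rewrite /T; field; rewrite !lt0r_neq0.
lra.
Qed.
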